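(* Consider the one-period game described in the context, with government price $p_g>\max\{p_0,I\}$. Then in every (perfect Bayesian) equilibrium: (i) a firm of type $\theta$ sells its asset (to the government or to the market), at price $p_g$, if and only if $\theta<p_g+S$; in particular, since $p_g>p_0$, strictly more firms sell and fund their projects than in the laissez-faire outcome (where exactly the types $\theta\le\theta_0$ sell). (ii) If $\mu_m>0$ (the market is active), then $\bar\theta_g<\bar\theta_m$, i.e., on average lower-value assets are sold to the government than to the market.
   Context: Types: a continuum of firms with privately known type $\theta\in[0,1]$, distributed with cdf $F$ and density $f>0$, where $f$ is strictly log-concave. Each firm owns one unit of an asset worth $\theta$ and has a project requiring funding $I>0$ with net return $S>0$; the project can be funded only by selling the asset. A firm that sells at price $p\ge I$ gets payoff $p+S$; a firm that does not sell gets $\theta$. Laissez-faire benchmark: $\theta_0\in(0,1)$ is the unique solution of $\theta_0-S=\mathbb{E}[\theta\mid\theta\le\theta_0]$, and $p_0:=\mathbb{E}[\theta\mid\theta\le\theta_0]$; without intervention exactly the types $\theta\le\theta_0$ sell at price $p_0$. One-period game: the government first announces that it will buy one unit at price $p_g$; then competitive, risk-neutral buyers make price offers (Bertrand competition; buyers break even in expectation; an indifferent buyer buys); then each firm chooses to sell to the government, to sell to the market, or not to sell. Equilibrium means perfect Bayesian equilibrium. Among the types $\theta\le p_g+S$, let $\mu_g$ and $\mu_m=1-\mu_g$ be the fractions selling to the government and to the market, and $\bar\theta_g$, $\bar\theta_m$ the average asset values of those two groups.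
   Formalization: Part (i) is stated for every type except θ = p_g+S: that single type is indifferent between selling at p_g and not selling, so with no tie-breaking rule an equilibrium in which it sells exists and the literal ''if and only if'' fails there. *)

(* Defs.v *)
From HB Require Import structures.
From mathcomp Require Import all_boot all_order all_algebra.
From mathcomp Require Import all_classical all_reals all_analysis.
Set Implicit Arguments. Unset Strict Implicit. Unset Printing Implicit Defensive.
Import Order.TTheory GRing.Theory Num.Theory.
Local Open Scope classical_set_scope.
Local Open Scope ring_scope.

Section Defs.
Variable R : realType.

Definition integ (D : set R) (h : R -> R) : R :=
  Rintegral (@lebesgue_measure R) D h.

Definition tcdf (f : R -> R) (x : R) : R := integ `[0, x] f.

Definition cmean (f : R -> R) (x : R) : R :=
  integ `[0, x] (fun t => t * f t) / tcdf f x.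

Definition strictly_log_concave (f : R -> R) : Prop :=
  forall x y t : R, 0 <= x <= 1 -> 0 <= y <= 1 -> x != y -> 0 < t < 1 ->
    t * ln (f x) + (1 - t) * ln (f y) < ln (f (t * x + (1 - t) * y)).

(* payoff of a firm selling at price p: it can fund the project iff p >= I *)
Definition sale_payoff (I S p : R) : R := if I <= p then p + S else p.

(* optimality of the mixed action (g = prob. of selling to government,
   m = prob. of selling to the market, 1-g-m = prob. of not selling)
   of a firm of type th when the best market offer is p *)
Definition firm_opt (pg I S p th g m : R) : Prop :=
  [/\ 0 <= g, 0 <= m, g + m <= 1 &
   [/\ (0 < g -> sale_payoff I S p <= sale_payoff I S pg /\ th <= sale_payoff I S pg),
      (0 < m -> sale_payoff I S pg <= sale_payoff I S p /\ th <= sale_payoff I S p)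
    & (g + m < 1 -> sale_payoff I S pg <= th /\ sale_payoff I S p <= th)]].

Definition buyer_profit (f : R -> R) (m : R -> R -> R) (p : R) : R :=
  integ `[0, 1] (fun th => (th - p) * m p th * f th).

(* Perfect Bayesian equilibrium of the one-period game.
   g p th, m p th : the (mixed) choice of type th after the market offer p
   (firms' strategies are specified in every subgame p);
   pstar : the equilibrium (highest) market offer. *)
Definition is_equilibrium (f : R -> R) (pg I S : R)
    (g m : R -> R -> R) (pstar : R) : Prop :=
  [/\ (forall p th, 0 <= th <= 1 -> firm_opt pg I S p th (g p th) (m p th)),
      (forall p : R, measurable_fun (`[0, 1] : set R) (g p)),
      (forall p : R, measurable_fun (`[0, 1] : set R) (m p)),
      (* buyers break even (an indifferent buyer buys) *)
      buyer_profit f m pstar = 0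
    & (* Bertrand competition: no buyer gains by outbidding *)
      (forall p, pstar < p -> buyer_profit f m p <= 0)].

End Defs.

(* Main.v *)
Require Import Defs.
From HB Require Import structures.
From mathcomp Require Import all_boot all_order all_algebra.
From mathcomp Require Import all_classical all_reals all_analysis.
From mathcomp Require Import measurable_realfun ring lra.
Import Order.TTheory GRing.Theory Num.Theory.
Local Open Scope classical_set_scope.
Local Open Scope ring_scope.

(* Log-concavity of f makes x - E[theta | theta <= x] increasing in x, so at
   any price p above p_0 the average value of the types willing to sell at p
   is below p.  A market offer above p_g would attract exactly these types and
   lose money; an offer below p_g attracts nobody.  Hence an active market
   trades at p_g, where zero profit means that the average asset sold to the
   market is worth p_g; as the average over all sellers is smaller than p_g, so
   is the average over those selling to the government. *)

(** * Translation of Lebesgue integrals *)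

(** Lebesgue measure is determined by its values on half-open intervals, and a translation preserves
    their length. *)
Lemma lebesgue_measure_shift (R : realType) (h : R) (A : set R) : measurable A ->
  pushforward (@lebesgue_measure R)
    ((fun x => x + h) : measurableTypeR R -> measurableTypeR R) A =
  lebesgue_measure A.
Proof.
have mphi : measurable_fun setT ((fun x => x + h) : measurableTypeR R -> measurableTypeR R).
  by apply: measurable_funD; [exact: measurable_id|exact: measurable_cst].
move=> mA; apply/esym; move: A mA; apply: lebesgue_measure_unique => A [[a b] _ <-].
rewrite /= /pushforward /=.
have -> : (fun x : R => x + h) @^-1` `]a, b]%classic = `](a - h), (b - h)]%classic.
  by apply/seteqP; split => x /=; rewrite !in_itv /= ltrBlDr lerBrDr.
rewrite !lebesgue_measure_itv /= !lte_fin ltrD2r.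
by case: ifP => // _; rewrite -!EFinD; congr (_%:E); lra.
Qed.

(** Both integrands are extended by zero to the whole line, where translation invariance of the
    measure gives the change of variables. Integrability is part of the conclusion because the
    comparison of integrals in [mean_gap] requires it. *)
Lemma integral_shift (R : realType) (D : set R) (k : R -> R) (h : R) :
  measurable D -> lebesgue_measure.-integrable D (EFin \o k) ->
  lebesgue_measure.-integrable ((fun x => x - h) @^-1` D)
    (EFin \o (fun x => k (x - h))) /\
  integ ((fun x => x - h) @^-1` D) (fun x => k (x - h)) = integ D k.
Proof.
move=> mD ik.
pose phi := (fun x => x + h) : measurableTypeR R -> measurableTypeR R.
pose psi := (fun x => x - h) : measurableTypeR R -> measurableTypeR R.
have mphi : measurable_fun setT phi.
  by apply: measurable_funD; [exact: measurable_id|exact: measurable_cst].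
have mpsi : measurable_fun setT psi.
  by apply: measurable_funB; [exact: measurable_id|exact: measurable_cst].
have mD' : measurable (psi @^-1` D) by have := mpsi measurableT D mD; rewrite setTI.
have phiK (x : R) : psi (phi x) = x by rewrite /phi /psi addrK.
pose k' := (EFin \o k) \_ D.
have ik' : lebesgue_measure.-integrable setT k' 
  by have [+ _] := @integrable_mkcond _ _ _ lebesgue_measure _ (EFin \o k) mD; exact.
have mk' : measurable_fun setT (k' \o psi).
  by apply: measurableT_comp => //; exact: measurable_int ik'.
have k'phi : k' \o psi \o phi = k' by apply/funext => x /=; rewrite phiK.
have shiftE (g : R -> \bar R) : (\int[lebesgue_measure]_x g x =
    \int[pushforward lebesgue_measure phi]_x g x)%E.
  by apply: eq_measure_integral => A mA _; apply/esym/lebesgue_measure_shift.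
have k'psi : (EFin \o (k \o psi)) \_ (psi @^-1` D) = k' \o psi.
  by apply/funext => x; rewrite /k' !patchE /=.
split.
  have [_] := @integrable_mkcond _ _ _ lebesgue_measure _ (EFin \o (k \o psi)) mD'; apply.
  rewrite [X in _.-integrable _ X]k'psi.
  apply/integrableP; split => //.
  rewrite shiftE ge0_integral_pushforward //=; last first.
    exact: measurableT_comp.
  rewrite preimage_setT.
  have /integrableP[_] := ik'.
  by under eq_integral do rewrite -{1}[k']k'phi.
rewrite /integ /Rintegral integral_mkcond [X in fine (integral _ _ X)]k'psi [in RHS]integral_mkcond.
congr fine; rewrite shiftE integral_pushforward //=; last first.
  by rewrite preimage_setT -[X in _.-integrable _ X]/(k' \o psi \o phi) k'phi.
by rewrite preimage_setT -[X in integral _ _ X]/(k' \o psi \o phi) k'phi.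
Qed.

(** * Integrability and strict positivity on intervals *)

Lemma integrable_subitv (R : realType) (k : R -> R) (a b c d : R) :
  c <= a -> b <= d -> lebesgue_measure.-integrable `[c, d] (EFin \o k) ->
  lebesgue_measure.-integrable `[a, b] (EFin \o k).
Proof.
move=> ca bd ik; apply: integrableS ik => // t /=; rewrite !in_itv /=.
by move=> /andP[at_ tb]; rewrite (le_trans ca at_) (le_trans tb bd).
Qed.

(** A nonnegative function with zero integral vanishes almost everywhere, but here the exceptional
    set would contain []a, b[], of positive length. Strictness is asked only in the interior, since
    some integrands below may vanish at an endpoint. *)
Lemma Rintegral_itv_gt0 (R : realType) (k : R -> R) (a b : R) : a < b ->
  lebesgue_measure.-integrable `[a, b] (EFin \o k) ->
  (forall x, a <= x <= b -> 0 <= k x) -> (forall x, a < x < b -> 0 < k x) ->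
  0 < integ `[a, b] k.
Proof.
move=> ab ik k_ge0 k_gt0.
rewrite lt_neqAle Rintegral_ge0 ?andbT; last first.
  by move=> x /=; rewrite in_itv; exact: k_ge0.
apply/negP => /eqP/esym k0.
have : ae_eq lebesgue_measure `[a, b]%classic (EFin \o k) (cst 0%E).
  apply/ae_eq_integral_abs => //; first exact: measurable_int ik.
  rewrite -[RHS]/(0%:E) -k0 /integ /Rintegral fineK; last first.
    exact: integrable_fin_num ik.
  apply: eq_integral => x; rewrite inE /= in_itv /= => xab.
  by rewrite ger0_norm // k_ge0.
case=> N [mN N0 kN].
have : (lebesgue_measure `]a, b[%classic <= lebesgue_measure N)%E.
  apply: le_measure; rewrite ?inE // => x /=; rewrite in_itv /= => xab.
  apply: kN => /= kx; have /andP[ax xb] := xab.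
  have : k x = 0 by apply/EFin_inj/kx; rewrite in_itv /= !ltW.
  by move=> kx0; have := k_gt0 _ xab; rewrite kx0 ltxx.
rewrite N0 lebesgue_measure_itv /= lte_fin ab -EFinD lee_fin.
by lra.
Qed.

Lemma integrable_bounded_mul (R : realType) (D : set R) (k f : R -> R) (M : R) :
  measurable D -> measurable_fun D k -> (forall x, D x -> `|k x| <= M) ->
  lebesgue_measure.-integrable D (EFin \o f) ->
  lebesgue_measure.-integrable D (EFin \o (fun x => k x * f x)).
Proof.
move=> mD mk kM; apply: integrableMr => //.
exists M; split; first exact: num_real.
by move=> N MN x Dx /=; exact: le_trans (kM x Dx) (ltW MN).
Qed.

(** [Rintegral] sends an infinite integral to 0 through [fine], so a nonzero value certifies
    finiteness. *)
Lemma density_integrable (R : realType) (D : set R) (f : R -> R) :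
  measurable D -> measurable_fun D f -> (forall x, D x -> 0 <= f x) ->
  integ D f != 0 -> lebesgue_measure.-integrable D (EFin \o f).
Proof.
move=> mD mf f_ge0 intf; apply/integrableP; split; first exact/measurable_EFinP.
under eq_integral => x /set_mem /f_ge0 fx do rewrite gee0_abs ?lee_fin //.
rewrite ltey; apply: contraNneq intf => /= infty.
by rewrite /integ /Rintegral infty.
Qed.

(** * Log-concavity and truncated means *)

(** The points [t] and [s + h] are convex combinations of [s] and [t + h] with swapped weights [l]
    and [1 - l]; adding the two log-concavity inequalities makes the weights disappear. *)
Lemma log_concave_exchange (R : realType) (f : R -> R) (s t h : R) :
  (forall x, 0 <= x <= 1 -> 0 < f x) -> strictly_log_concave f ->
  0 <= s -> s <= t -> 0 <= h -> t + h <= 1 ->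
  f s * f (t + h) <= f (s + h) * f t.
Proof.
move=> fpos lc s0; rewrite le_eqVlt => /predU1P[->|st]; first by move=> *; rewrite mulrC.
rewrite le_eqVlt => /predU1P[<-|h0] th1; first by rewrite !addr0.
pose l := h / (t + h - s).
have d0 : 0 < t + h - s by lra.
have l01 : 0 < l < 1 by rewrite /l divr_gt0 //= ltr_pdivrMr // mul1r; lra.
have ld : l * (t + h - s) = h by rewrite /l divfK // gt_eqF.
have hs : 0 <= s <= 1 by lra.
have hth : 0 <= t + h <= 1 by lra.
have ne : s != t + h by rewrite lt_eqF //; lra.
have lc1 := lc s (t + h) l hs hth ne l01.
have lc2 := lc (t + h) s l hth hs (contra_neq (@esym _ _ _) ne) l01.
have e1 : l * s + (1 - l) * (t + h) = t by transitivity (t + h - l * (t + h - s)); [|rewrite ld]; ring.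
have e2 : l * (t + h) + (1 - l) * s = s + h by transitivity (s + l * (t + h - s)); [|rewrite ld]; ring.
rewrite {}e1 in lc1; rewrite {}e2 in lc2.
have ft : 0 < f t by apply: fpos; lra.
have fsh : 0 < f (s + h) by apply: fpos; lra.
have [fs fth] := (fpos s hs, fpos _ hth).
rewrite -ler_ln ?posrE ?mulr_gt0 // !lnM ?posrE //.
by lra.
Qed.

Lemma integrable_affine_mul (R : realType) (f : R -> R) (c a b : R) :
  0 <= a -> b <= 1 ->
  lebesgue_measure.-integrable `[0, 1] (EFin \o f) ->
  lebesgue_measure.-integrable `[a, b] (EFin \o (fun t => (c - t) * f t)).
Proof.
move=> a0 b1 intf; apply: (@integrable_bounded_mul _ _ _ _ (`|c| + 1)) => //.
- exact: measurable_funB.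
- move=> x /=; rewrite in_itv /= => /andP[ax xb].
  by rewrite (le_trans (ler_normB _ _)) // lerD2l ger0_norm; lra.
- by apply: integrable_subitv intf; lra.
Qed.

(* After translating [h, y + h] to [0, y], log-concavity makes the likelihood
   ratio f (u + h) / f u nonincreasing, so (a - u) f (u + h) dominates
   (f (a + h) / f a) (a - u) f u, whose integral is zero. *)
Lemma mean_gap (R : realType) (f : R -> R) (a y h : R) :
  (forall x, 0 <= x <= 1 -> 0 < f x) -> strictly_log_concave f ->
  lebesgue_measure.-integrable `[0, 1] (EFin \o f) ->
  0 <= a <= y -> 0 < h -> y + h <= 1 ->
  integ `[0, y] (fun t => (a - t) * f t) = 0 ->
  0 < integ `[0, y + h] (fun t => (a + h - t) * f t).
Proof.
move=> fpos lc intf /andP[a0 ay] h0 yh1 mean0.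
set K := fun t => (a + h - t) * f t.
have intK c d : 0 <= c -> d <= 1 ->
    lebesgue_measure.-integrable `[c, d] (EFin \o K).
  by move=> ? ?; exact: integrable_affine_mul.
have K1 : 0 < integ `[0, h] K.
  apply: Rintegral_itv_gt0 => //; first by apply: intK; lra.
    move=> x /andP[x0 xh]; rewrite /K mulr_ge0 //; first lra.
    by rewrite ltW // fpos //; lra.
  move=> x /andP[x0 xh]; rewrite /K mulr_gt0 //; first lra.
  by rewrite fpos //; lra.
have split_K : integ `[0, y + h] K = integ `[0, h] K + integ `[h, y + h] K.
  rewrite [RHS]addrC; apply/eqP; rewrite -subr_eq /integ Rintegral_itvB ?bnd_simp; [|by apply: intK; lra|lra|lra].
  apply/eqP/Rintegral_itv_obnd_cbnd/(integrableS _ _ _ (intK 0 (y + h) _ _)) => //.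
  by move=> x /=; rewrite !in_itv /= => /andP[hx xyh]; apply/andP; split; lra.
have fa : 0 < f a by apply: fpos; lra.
(* The piece on [[0, h]] supplies strictness, so nonnegativity suffices on [[h, y + h]]. Multiplying
   by [f a] avoids dividing in the likelihood-ratio comparison. *)
rewrite split_K ltr_pwDl // -(pmulr_rge0 _ fa).
have [] := @integral_shift _ `[0, y]%classic (fun t => (a - t) * f t) h.
- by [].
- by apply: integrable_affine_mul => //; lra.
have -> : (fun x => x - h) @^-1` `[0, y]%classic = `[h, y + h]%classic.
  by apply/seteqP; split => x /=; rewrite !in_itv /= subr_ge0 lerBlDr.
rewrite mean0 => ishift shift0.
rewrite /integ -RintegralZl //; last by apply: intK; lra.
rewrite -[leLHS](mulr0 (f (a + h))) -shift0 /integ -RintegralZl //.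
apply: le_Rintegral => //.
- exact: (@integrable_bounded_mul _ _ (cst (f (a + h))) _ `|f (a + h)|).
- apply: (@integrable_bounded_mul _ _ (cst (f a)) _ `|f a|) => //.
  by apply: intK; lra.
move=> t /=; rewrite in_itv /= => /andP[ht tyh].
have th : t - h + h = t by rewrite subrK.
rewrite -subr_ge0 /K.
(* Both factors change sign at [t - h = a]: the second is nonnegative before and nonpositive after,
   by the exchange inequality. *)
rewrite (_ : _ - _ = (a - (t - h)) * (f a * f t - f (a + h) * f (t - h))); last by ring.
have [ta|at_] := leP (t - h) a.
  rewrite mulr_ge0 ?subr_ge0 // [leLHS]mulrC [leRHS]mulrC.
  have := @log_concave_exchange _ f (t - h) a h fpos lc.
  by rewrite th; apply; lra.
rewrite mulr_le0 ?subr_le0 ?(ltW at_) //.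
have := @log_concave_exchange _ f a (t - h) h fpos lc.
by rewrite th; apply; lra.
Qed.

(* The sign of p - E[theta | theta <= x], multiplied by tcdf f x. *)
Lemma overpayment (R : realType) (f : R -> R) (S theta0 p x : R) :
  (forall y, 0 <= y <= 1 -> 0 < f y) -> strictly_log_concave f ->
  lebesgue_measure.-integrable `[0, 1] (EFin \o f) ->
  0 < S -> 0 < theta0 -> theta0 - S = cmean f theta0 ->
  theta0 < x -> x <= 1 -> x - S <= p ->
  0 < integ `[0, x] (fun t => (p - t) * f t).
Proof.
move=> fpos lc intf S0 th0 fix0 thx x1 xp.
have th1 : theta0 <= 1 by lra.
have intf0 : lebesgue_measure.-integrable `[0, theta0] (EFin \o f).
  by apply: integrable_subitv intf; lra.
have cdf_gt0 : 0 < tcdf f theta0.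
  apply: Rintegral_itv_gt0 => // t /andP[t0 tth]; last by apply: fpos; lra.
  by rewrite ltW // fpos //; lra.
have a0 : 0 <= theta0 - S.
  rewrite fix0 divr_ge0 ?(ltW cdf_gt0) //; apply: Rintegral_ge0 => t /=.
  rewrite in_itv /= => /andP[t0 tth].
  by rewrite mulr_ge0 // ltW // fpos //; lra.
have intid : lebesgue_measure.-integrable `[0, theta0] (EFin \o (fun t => t * f t)).
  apply: (@integrable_bounded_mul _ _ id _ 1) => // t /=.
  by rewrite in_itv /= => /andP[t0 tth]; rewrite ger0_norm //; lra.
(* The fixed-point equation for [theta0], cleared of its denominator. *)
have mean0 : integ `[0, theta0] (fun t => (theta0 - S - t) * f t) = 0.
  transitivity (integ `[0, theta0] (fun t => (theta0 - S) * f t - t * f t)).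
    by apply: eq_Rintegral => t _; rewrite mulrBl.
  rewrite /integ RintegralB //; last first.
    exact: (@integrable_bounded_mul _ _ (cst (theta0 - S)) _ `|theta0 - S|).
  rewrite RintegralZl // fix0 /cmean -/(integ `[0, theta0] f).
  by rewrite -/(tcdf f theta0) divfK ?subrr // gt_eqF.
(* With this shift, [a + h] becomes [x - S], which is at most [p]; raising the price only increases
   the integral. *)
have := @mean_gap _ f (theta0 - S) theta0 (x - theta0) fpos lc intf.
rewrite subrKC => gap.
apply: lt_le_trans (gap _ _ _ _) _ => //; [by apply/andP; split; lra|lra|].
apply: le_Rintegral => //; try exact: integrable_affine_mul.
move=> t /=; rewrite in_itv /= => /andP[t0 tx].
apply: ler_wpM2r; last by lra.
by rewrite ltW // fpos //; lra.
Qed.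

(** * Cutoffs in integrals, and sale payoffs *)

(** The right endpoint is left free because a cutoff type may be indifferent, so its choice is not
    determined. *)
Lemma eq_integ_co (R : realType) (k1 k2 : R -> R) (a b : R) :
  lebesgue_measure.-integrable `[a, b] (EFin \o k1) ->
  lebesgue_measure.-integrable `[a, b] (EFin \o k2) ->
  {in `[a, b[, k1 =1 k2} -> integ `[a, b] k1 = integ `[a, b] k2.
Proof.
move=> i1 i2 k12; rewrite /integ.
have sub : `[a, b[%classic `<=` (`[a, b]%classic : set R).
  by move=> t /=; rewrite !in_itv /= => /andP[-> /ltW].
rewrite -Rintegral_itv_bndo_bndc; last by apply: integrableS i1.
rewrite -Rintegral_itv_bndo_bndc; last by apply: integrableS i2.
by apply: eq_Rintegral => t; rewrite inE; exact: k12.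
Qed.

Lemma integ_truncate (R : realType) (k : R -> R) (a c b : R) :
  a <= c -> c <= b -> lebesgue_measure.-integrable `[a, b] (EFin \o k) ->
  (forall t, c < t -> t <= b -> k t = 0) -> integ `[a, b] k = integ `[a, c] k.
Proof.
move=> ac cb ik k0; apply/eqP; rewrite -subr_eq0 /integ Rintegral_itvB ?bnd_simp //.
rewrite (@eq_Rintegral _ _ _ _ _ (cst 0)); last first.
  by move=> t; rewrite inE /= in_itv /= => /andP[ct tb]; rewrite k0.
by rewrite Rintegral_cst // mul0r.
Qed.

Lemma sale_payoff_ge (R : realType) (I S p : R) : I <= p -> sale_payoff I S p = p + S.
Proof. by rewrite /sale_payoff => ->. Qed.

Lemma sale_payoff_le (R : realType) (I S p : R) : 0 <= S -> sale_payoff I S p <= p + S.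
Proof. by move=> S0; rewrite /sale_payoff; case: ifP => _ //; rewrite lerDl. Qed.

(** * Equilibrium behaviour and average asset values *)

Theorem theorem1 (R : realType) (f : R -> R) (I S pg theta0 : R) :
  0 < I -> 0 < S ->
  measurable_fun (`[0, 1] : set R) f ->
  (forall x, 0 <= x <= 1 -> 0 < f x) ->
  integ `[0, 1] f = 1 ->
  strictly_log_concave f ->
  0 < theta0 < 1 ->
  theta0 - S = cmean f theta0 ->
  Num.max (theta0 - S) I < pg ->
  forall (g m : R -> R -> R) (pstar : R),
    is_equilibrium f pg I S g m pstar ->
    let c := Num.min (pg + S) 1 in
    let mass_g := integ `[0, c] (fun th => g pstar th * f th) in
    let mass_m := integ `[0, c] (fun th => m pstar th * f th) in
    let mu_m := mass_m / tcdf f c in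
    let avg_g := integ `[0, c] (fun th => th * g pstar th * f th) / mass_g in
    let avg_m := integ `[0, c] (fun th => th * m pstar th * f th) / mass_m in
    (* (i) *)
    (forall th, 0 <= th <= 1 -> th != pg + S ->
       [/\ g pstar th + m pstar th = 1 <-> th < pg + S,
           g pstar th + m pstar th = 0 <-> pg + S < th
         & 0 < m pstar th -> pstar = pg]) /\
    tcdf f theta0 < tcdf f c /\
    (* (ii) *)
    (0 < mu_m -> avg_g < avg_m).
Proof.
move=> I0 S0 mf fpos intf1 lc /andP[th0 th1] fix0.
rewrite gt_max => /andP[pg_th pgI] g m pstar [opt mg mm bp0 _].
move=> c mass_g mass_m mu_m avg_g avg_m.
have fge0 x : 0 <= x <= 1 -> 0 <= f x by move=> ?; exact/ltW/fpos.
have intf : lebesgue_measure.-integrable `[0, 1] (EFin \o f).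
  by apply: density_integrable => //; rewrite intf1 oner_neq0.
have pay_g : sale_payoff I S pg = pg + S by rewrite sale_payoff_ge // ltW.
have thc : theta0 < c by rewrite lt_min th1 andbT; lra.
have c1 : c <= 1 by rewrite ge_min lexx orbT.
have cpg : c <= pg + S by rewrite ge_min lexx.
have m01 th : 0 <= th <= 1 -> 0 <= m pstar th <= 1.
  by move=> /(opt pstar)[g0 m0 gm _]; apply/andP; split=> //; lra.
have g01 th : 0 <= th <= 1 -> 0 <= g pstar th <= 1.
  by move=> /(opt pstar)[g0 m0 gm _]; apply/andP; split=> //; lra.
have intk (k : R -> R) w a b : 0 <= a -> b <= 1 ->
    measurable_fun (`[0, 1]%classic : set R) k ->
    (forall t, 0 <= t <= 1 -> 0 <= k t <= 1) ->
    lebesgue_measure.-integrable `[a, b] (EFin \o (fun t => (t - w) * k t * f t)).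
  move=> a0 b1 mk k01.
  suff ik : lebesgue_measure.-integrable `[0, 1] (EFin \o (fun t => (t - w) * k t * f t)).
    by apply: integrable_subitv ik; lra.
  apply: (@integrable_bounded_mul _ _ _ _ (1 + `|w|)) => //.
    by apply: measurable_funM => //; exact: measurable_funB.
  move=> t /=; rewrite in_itv /= => t01.
  have /andP[kt0 kt1] := k01 t t01; have /andP[t0 t1] := t01.
  rewrite normrM -[leRHS]mulr1 ler_pM //; last by rewrite ger0_norm.
  by rewrite (le_trans (ler_normB _ _)) // lerD2r ger0_norm.
(* If the market outbid the government, all types below [c'] would sell to it and those above
   [pstar + S] would keep the asset; [overpayment] then makes the buyers' profit negative, against
   [bp0]. *)
have pstar_le : pstar <= pg.
  rewrite leNgt; apply/negP => pg_lt.
  have pay_m : sale_payoff I S pstar = pstar + S by rewrite sale_payoff_ge //; lra.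
  pose c' := Num.min (pstar + S) 1.
  have thc' : theta0 < c' by rewrite lt_min th1 andbT; lra.
  have c'1 : c' <= 1 by rewrite ge_min lexx orbT.
  have c'p : c' <= pstar + S by rewrite ge_min lexx.
  have g0 th : 0 <= th <= 1 -> g pstar th = 0.
    move=> /(opt pstar)[g0 _ _ []]; rewrite pay_g pay_m => [Hg _ _].
    apply/eqP; rewrite eq_le g0 andbT leNgt; apply/negP => /Hg[]; lra.
  have := @overpayment _ f S theta0 pstar c' fpos lc intf S0 th0 fix0 thc' c'1.
  move=> /(_ ltac:(lra)).
  have <- : integ `[0, c'] (fun t => (-1) * ((t - pstar) * m pstar t * f t)) =
            integ `[0, c'] (fun t => (pstar - t) * f t).
    apply: eq_integ_co.
    - apply: (@integrable_bounded_mul _ _ (cst (-1)) _ `|-1|) => //.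
      exact: intk.
    - exact: integrable_affine_mul.
    move=> t; rewrite in_itv /= => /andP[t0 tc'].
    have t01 : 0 <= t <= 1 by lra.
    have -> : m pstar t = 1; last by ring.
    have [_ _ gm [_ _]] := opt pstar t t01.
    rewrite g0 // add0r in gm *; rewrite pay_m => Hn.
    apply/eqP; rewrite eq_le gm leNgt; apply/negP => /Hn[]; lra.
  rewrite /integ RintegralZl //; last by apply: intk => //.
  rewrite -[X in -1 * X](@integ_truncate _ _ 0 c' 1) //.
  - by rewrite -/(buyer_profit f m pstar) bp0 mulr0 ltxx.
  - lra.
  - exact: intk.
  - move=> t ct t1; suff -> : m pstar t = 0 by rewrite mulr0 mul0r.
    have t01 : 0 <= t <= 1 by lra.
    have [_ m0 _ [_ Hm _]] := opt pstar t t01.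
    move: ct; rewrite gt_min => /orP[ct|]; last lra.
    by apply/eqP; rewrite eq_le m0 andbT leNgt; apply/negP => /Hm[]; lra.
(* This holds whether or not [pstar] covers [I], so the government's offer is always a best sale and
   fixes the cutoff [pg + S]. *)
have pay_m : sale_payoff I S pstar <= pg + S.
  by have := @sale_payoff_le _ I S pstar (ltW S0); lra.
have gm1 th : 0 <= th <= 1 -> th < pg + S -> g pstar th + m pstar th = 1.
  move=> /(opt pstar)[_ _ gm [_ _ Hn]] thp; rewrite pay_g in Hn.
  by apply/eqP; rewrite eq_le gm leNgt; apply/negP => /Hn[]; lra.
have gm0 th : 0 <= th <= 1 -> pg + S < th -> g pstar th = 0 /\ m pstar th = 0.
  move=> /(opt pstar)[g0 m0 _ [Hg Hm _]] thp; rewrite pay_g in Hg.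
  split; apply/eqP; rewrite eq_le ?g0 ?m0 andbT leNgt; apply/negP.
    by move=> /Hg[]; lra.
  by move=> /Hm[]; lra.
(* A market sale needs [pg + S <= sale_payoff I S pstar <= pstar + S], which together with
   [pstar_le] forces equality. *)
have mpos th : 0 <= th <= 1 -> 0 < m pstar th -> pstar = pg.
  move=> /(opt pstar)[_ _ _ [_ Hm _]] /Hm[]; rewrite pay_g => pm _.
  by have := @sale_payoff_le _ I S pstar (ltW S0); lra.
have cdf_c : 0 < tcdf f c.
  apply: Rintegral_itv_gt0; first lra.
  - by apply: integrable_subitv intf; lra.
  - by move=> t ?; apply: fge0; lra.
  - by move=> t ?; apply: fpos; lra.
split.
  move=> th th01 thp; split; last exact: mpos.
    split=> [gm|]; last exact: gm1.
    rewrite lt_neqAle thp leNgt; apply/negP => /(gm0 _ th01)[]; lra.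
  split=> [gm|/(gm0 _ th01)[]]; last lra.
  by rewrite lt_neqAle eq_sym thp leNgt; apply/negP => /(gm1 _ th01); lra.
split.
  have intf_c : lebesgue_measure.-integrable `[0, c] (EFin \o f).
    by apply: integrable_subitv intf; lra.
  (* The added mass is the integral of the positive density over [[theta0, c]]. *)
  rewrite -subr_gt0 /tcdf /integ Rintegral_itvB ?bnd_simp //; [|lra|lra].
  rewrite Rintegral_itv_obnd_cbnd; last first.
    apply: integrableS intf_c => // t /=; rewrite !in_itv /= => /andP[tht tc].
    by rewrite tc andbT; lra.
  apply: Rintegral_itv_gt0 => //.
  - by apply: integrable_subitv intf_c; lra.
  - by move=> t ?; apply: fge0; lra.
  - by move=> t ?; apply: fpos; lra.
rewrite /mu_m pmulr_lgt0 ?invr_gt0 // => mass_m_gt0.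
have [th th01 mth] : exists2 th, 0 <= th <= 1 & 0 < m pstar th.
  apply: contrapT => nm; move: mass_m_gt0.
  rewrite /mass_m /integ (@eq_Rintegral _ _ _ _ _ (cst 0)).
    by rewrite Rintegral_cst // mul0r ltxx.
  move=> t; rewrite inE /= in_itv /= => tc; have t01 : 0 <= t <= 1 by lra.
  have /andP[m0 _] := m01 t t01.
  have -> : m pstar t = 0; last by rewrite mul0r.
  by apply/eqP; rewrite eq_le m0 andbT leNgt; apply/negP => mt; apply: nm; exists t.
have {th th01 mth}pE := mpos th th01 mth; subst pstar.
(* Total asset value minus total payment at price [pg], for the units sold according to [k]; its
   sign compares their average value with [pg]. *)
pose excess (k : R -> R) := integ `[0, c] (fun t => (t - pg) * k t * f t).
have excessE (k : R -> R) : measurable_fun (`[0, 1]%classic : set R) k ->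
    (forall t, 0 <= t <= 1 -> 0 <= k t <= 1) ->
    excess k = integ `[0, c] (fun t => t * k t * f t) -
               pg * integ `[0, c] (fun t => k t * f t).
  move=> mk k01.
  have ik : lebesgue_measure.-integrable `[0, c] (EFin \o (fun t => k t * f t)).
    suff ik : lebesgue_measure.-integrable `[0, 1] (EFin \o (fun t => k t * f t)).
      by apply: integrable_subitv ik; lra.
    apply: (@integrable_bounded_mul _ _ _ _ 1) => // t /=; rewrite in_itv /=.
    by move=> /k01/andP[? ?]; rewrite ger0_norm.
  rewrite /integ -RintegralZl // -RintegralB //.
  - by apply: eq_Rintegral => t _; ring.
  - have -> : (fun t => t * k t * f t) = (fun t => (t - 0) * k t * f t).
      by apply/funext => t; rewrite subr0.
    exact: intk.
  - exact: (@integrable_bounded_mul _ _ (cst pg) _ `|pg|).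
have mgm : measurable_fun (`[0, 1]%classic : set R) (fun t => g pg t + m pg t).
  exact: measurable_funD.
have gm01 t : 0 <= t <= 1 -> 0 <= g pg t + m pg t <= 1.
  by move=> /(opt pg)[g0 m0 gm _]; rewrite gm addr_ge0.
have bm0 : excess (m pg) = 0.
  rewrite -[RHS]bp0 /buyer_profit; apply/esym/integ_truncate => //; first lra.
    exact: intk.
  move=> t ct t1; have t01 : 0 <= t <= 1 by lra.
  move: ct; rewrite gt_min => /orP[ct|]; last lra.
  by have [_ ->] := gm0 t t01 ct; rewrite mulr0 mul0r.
(* Below [c] every type sells, so the pooled excess is negative by [overpayment]. The market's share
   of it is zero, hence the government's share is negative. *)
have eg_lt0 : excess (g pg) < 0.
  have := @overpayment _ f S theta0 pg c fpos lc intf S0 th0 fix0 thc c1.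
  move=> /(_ ltac:(lra)).
  have <- : integ `[0, c] (fun t => (-1) * ((t - pg) * (g pg t + m pg t) * f t)) =
            integ `[0, c] (fun t => (pg - t) * f t).
    apply: eq_integ_co.
    - apply: (@integrable_bounded_mul _ _ (cst (-1)) _ `|-1|) => //.
      exact: intk.
    - exact: integrable_affine_mul.
    move=> t; rewrite in_itv /= => /andP[t0 tc].
    by rewrite gm1; [ring|lra|lra].
  rewrite /integ RintegralZl //; last exact: intk.
  rewrite -[X in -1 * X]/(excess (fun t => g pg t + m pg t)).
  suff -> : excess (fun t => g pg t + m pg t) = excess (g pg) + excess (m pg).
    by rewrite bm0; lra.
  rewrite /excess /integ -RintegralD //; try exact: intk.
  by apply: eq_Rintegral => t _; ring.
rewrite excessE // -/mass_g in eg_lt0; rewrite excessE // -/mass_m in bm0.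
have num_g : 0 <= integ `[0, c] (fun t => t * g pg t * f t).
  apply: Rintegral_ge0 => t /=; rewrite in_itv /= => /andP[t0 tc].
  have t01 : 0 <= t <= 1 by lra.
  by rewrite !mulr_ge0 ?fge0 //; have /andP[] := g01 t t01.
have pg0 : 0 < pg by lra.
(* A nonnegative total value strictly below [pg * mass_g] forces [mass_g] to be positive, so [avg_g]
   is a genuine average. *)
have mass_g_gt0 : 0 < mass_g by rewrite -(pmulr_rgt0 _ pg0); lra.
rewrite /avg_m ltr_pdivlMr // (_ : integ _ _ = pg * mass_m); last lra.
by rewrite ltr_pM2r // /avg_g ltr_pdivrMr //; lra.
Qed.
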